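(* Let $K$ be a number field (viewed inside $\mathbb{C}$) and let $A=\begin{pmatrix}a_{11}&a_{12}\\ a_{21}&a_{22}\end{pmatrix}\in \mathrm{GL}_2(K)$, with combined matrix $\mathcal{C}(A)=A\circ (A^{-1})^T$. Then: 1. $\mathrm{Tr}(\mathcal{C}(A))=\dfrac{2}{\det A}a_{11}a_{22}$. 2. $\det(\mathcal{C}(A))=\dfrac{1}{\det A}(a_{11}a_{22}+a_{12}a_{21})$. 3. The characteristic polynomial of $\mathcal{C}(A)$ is $\lambda^2-\left(\dfrac{2a_{11}a_{22}}{a_{11}a_{22}-a_{12}a_{21}}\right)\lambda+\dfrac{a_{11}a_{22}+a_{12}a_{21}}{a_{11}a_{22}-a_{12}a_{21}}$. 4. The eigenvalues of $\mathcal{C}(A)$ are $\{1,\det \mathcal{C}(A)\}$. 5. The vectors $\begin{pmatrix}1\\1\end{pmatrix},\begin{pmatrix}1\\-1\end{pmatrix}$ form a basis of eigenvectors of $\mathcal{C}(A)$. 6. The Galois group $\mathrm{Gal}(L/K)$ of the characteristic polynomial of $\mathcal{C}(A)$, where $L$ is its splitting field over $K$, is the trivial group. 7. $\mathcal{C}(A)$ is orthogonally diagonalizable: $\mathcal{C}(A)=PDP^T$ with $P=P^T=\dfrac{1}{\sqrt2}\begin{pmatrix}1&1\\1&-1\end{pmatrix}$ and $D=\begin{pmatrix}1&0\\0&\det(\mathcal{C}(A))\end{pmatrix}$. Moreover, if $f$ is a function analytic at $1$ and at $\det(\mathcal{C}(A))$, then $$f(\mathcal{C}(A))=\frac12\b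egin{pmatrix}1&1\\1&-1\end{pmatrix}\begin{pmatrix}f(1)&0\\0&f(\det(\mathcal{C}(A)))\end{pmatrix}\begin{pmatrix}1&1\\1&-1\end{pmatrix}.$$
   Context: A number field is a finite extension of $\mathbb{Q}$. $\circ$ denotes the Hadamard (entrywise) product; the combined matrix of a non-singular matrix $A$ is $\mathcal{C}(A)=A\circ (A^{-1})^T$. The characteristic polynomial of $M$ is $\det(M-\lambda I_n)$. $f(\mathcal{C}(A))$ is the usual matrix function obtained from the holomorphic functional calculus. *)

(* Defs.v *)
From HB Require Import structures.
From mathcomp Require Import all_boot all_order all_fingroup all_algebra all_field.
From mathcomp Require Import complex.
From mathcomp Require Import all_classical all_reals all_analysis.

Set Implicit Arguments.
Unset Strict Implicit.
Unset Printing Implicit Defensive.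

Import Order.TTheory GRing.Theory Num.Theory.
Import numFieldNormedType.Exports.

Local Open Scope classical_set_scope.
Local Open Scope ring_scope.

Definition hadamard (F : comPzRingType) (m n : nat) (A B : 'M[F]_(m, n)) :
  'M[F]_(m, n) := map2_mx *%R A B.

Definition combined_mx (F : fieldType) (n : nat) (A : 'M[F]_n) : 'M[F]_n :=
  hadamard A (invmx A)^T.

(* The library's [char_poly M] is \det ('X%:M - M), which differs from this one
   by the factor (-1) ^+ n. *)
Definition charpoly (F : comNzRingType) (n : nat) (M : 'M[F]_n) : {poly F} :=
  \det (map_mx polyC M - 'X%:M).

Definition mx2 (F : nmodType) (a b c d : F) : 'M[F]_2 :=
  \matrix_(i, j) nth 0 (nth [::] [:: [:: a; b]; [:: c; d]] i) j.

Definition col2 (F : nmodType) (a b : F) : 'cV[F]_2 := \col_i nth 0 [:: a; b] i.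

(* Column eigenvectors, whereas the library's [eigenspace] consists of rows;
   the eigenvalues are the same. *)
Definition eigenvector (F : fieldType) (n : nat) (M : 'M[F]_n) (v : 'cV[F]_n) :
  Prop := v != 0 /\ exists a : F, M *m v = a *: v.

Definition orthogonal_mx (F : fieldType) (n : nat) (P : 'M[F]_n) : Prop :=
  P *m P^T = 1%:M.

Definition analytic_at (C : numFieldType) (f : C -> C) (c : C) : Prop :=
  exists a : nat -> C,
    \forall z \near c, series (fun k => a k * (z - c) ^+ k) @ \oo --> f z.

Section FunctionalCalculus.
Context {R : realType}.
Implicit Types (f g : R[i] -> R[i]) (c : R[i]) (r : R).

Definition circle_pt c r (t : R) : R[i] := c + (r * cos t +i* (r * sin t))%C.

(* The integral of g(z) dz over the positively oriented circle |z - c| = r, with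
   z = c + r e^(it) and dz = i (z - c) dt. *)
Definition circle_integral g c r : R[i] :=
  let h t := g (circle_pt c r t) * ('i%C * (circle_pt c r t - c)) in
  ((\int[lebesgue_measure]_(t in `[0%R, 2 * pi]) complex.Re (h t)) +i*
   (\int[lebesgue_measure]_(t in `[0%R, 2 * pi]) complex.Im (h t)))%C.

Definition spectrum (n : nat) (M : 'M[R[i]]_n) : set R[i] :=
  [set a | eigenvalue M a].

(* (2 pi i)^-1 times the integral of f(z) (z I - M)^-1 dz over the union of the
   circles of radius r centred at the distinct eigenvalues of M. *)
Definition dunford_integral f (n : nat) (M : 'M[R[i]]_n) r : 'M[R[i]]_n :=
  \matrix_(i, j) ((2 * 'i%C * (pi : R)%:C%C)^-1 *
    \sum_(a \in spectrum M)
      circle_integral (fun z => f z * invmx (z%:M - M) i j) a r).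

(* B = f(M) in the holomorphic functional calculus.  For f analytic at the
   eigenvalues of M, all small enough r give an admissible contour: the discs
   are disjoint and f is analytic on them. *)
Definition is_matrix_function f (n : nat) (M B : 'M[R[i]]_n) : Prop :=
  \forall r \near 0^'+, dunford_integral f M r = B.

End FunctionalCalculus.

(* Main.v *)
(* With D = det A, p = a11 a22 / D and q = - a12 a21 / D, the combined matrix is
   [[p, q], [q, p]] with p + q = 1 and p - q = det C(A); everything algebraic follows.
   For the functional calculus, the resolvent has entries e1 / (z - 1) + e2 / (z - d)
   with e1 = 1/2 and e2 = +-1/2, so each circle integral is a mean value over
   |z - c| = r of f times a function analytic near c.  Instead of exchanging sums and
   integrals, such a function is approximated uniformly on the circle by polynomials in
   z - c with the right constant term; the mean value of a polynomial is read off
   from the integrals of cos (n t) and sin (n t). *)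
Require Import Defs.
From HB Require Import structures.
From mathcomp Require Import all_boot all_order all_fingroup all_algebra all_field.
From mathcomp Require Import complex.
From mathcomp Require Import all_classical all_reals all_analysis.
From mathcomp Require Import ring lra.

Set Implicit Arguments.
Unset Strict Implicit.
Unset Printing Implicit Defensive.

Import Order.TTheory GRing.Theory Num.Theory.
Import numFieldNormedType.Exports.

Local Open Scope classical_set_scope.
Local Open Scope ring_scope.

(** * Two-by-two matrices by their entries *)

Section Matrix2.
Variable F : comNzRingType.
Implicit Types (a b c d : F) (A : 'M[F]_2).

Lemma mx2_eta A : A = mx2 (A 0 0) (A 0 1) (A 1 0) (A 1 1).
Proof.
apply/matrixP => i j; rewrite mxE.
by case: i j => [[|[|//]] hi] [[|[|//]] hj] /=; congr (A _ _); apply/val_inj.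
Qed.

Lemma mx2_00 a b c d : mx2 a b c d 0 0 = a. Proof. by rewrite mxE. Qed.
Lemma mx2_01 a b c d : mx2 a b c d 0 1 = b. Proof. by rewrite mxE. Qed.
Lemma mx2_10 a b c d : mx2 a b c d 1 0 = c. Proof. by rewrite mxE. Qed.
Lemma mx2_11 a b c d : mx2 a b c d 1 1 = d. Proof. by rewrite mxE. Qed.
Definition mx2E := (mx2_00, mx2_01, mx2_10, mx2_11).

Lemma sum2 (f : 'I_2 -> F) : \sum_i f i = f 0 + f 1.
Proof.
by rewrite !big_ord_recl big_ord0 addr0; congr (_ + f _); apply/val_inj.
Qed.

Lemma mul_mx2 a b c d a' b' c' d' : mx2 a b c d *m mx2 a' b' c' d' =
  mx2 (a * a' + b * c') (a * b' + b * d') (c * a' + d * c') (c * b' + d * d').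
Proof. by rewrite [LHS]mx2_eta !mxE !sum2 !mx2E. Qed.

Lemma mul_mx2_col a b c d u v :
  mx2 a b c d *m col2 u v = col2 (a * u + b * v) (c * u + d * v).
Proof.
by apply/colP => i; rewrite !mxE sum2 !mxE; case: i => [[|[|//]] hi].
Qed.

Lemma scale_mx2 e a b c d : e *: mx2 a b c d = mx2 (e * a) (e * b) (e * c) (e * d).
Proof. by rewrite [LHS]mx2_eta !mxE. Qed.

Lemma scale_col2 e a b : e *: col2 a b = col2 (e * a) (e * b).
Proof. by apply/colP => i; rewrite !mxE; case: i => [[|[|//]] hi]. Qed.

Lemma tr_mx2 a b c d : (mx2 a b c d)^T = mx2 a c b d.
Proof. by rewrite [LHS]mx2_eta !mxE. Qed.

Lemma scalar_mx2 a : a%:M = mx2 a 0 0 a.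
Proof. by rewrite [LHS]mx2_eta !mxE. Qed.

Lemma sub_mx2 a b c d a' b' c' d' :
  mx2 a b c d - mx2 a' b' c' d' = mx2 (a - a') (b - b') (c - c') (d - d').
Proof. by rewrite [LHS]mx2_eta !mxE. Qed.

Lemma trace_mx2 a b c d : \tr (mx2 a b c d) = a + d.
Proof. by rewrite /mxtrace sum2 !mx2E. Qed.

Lemma det_mx2 a b c d : \det (mx2 a b c d) = a * d - b * c.
Proof.
rewrite (expand_det_row _ 0) sum2 /cofactor !det_mx11 !mxE /=.
by rewrite /bump /= expr0 expr1 mul1r mulN1r mulrN.
Qed.

End Matrix2.

Lemma map_mx2 (F F' : comNzRingType) (f : {rmorphism F -> F'}) (a b c d : F) :
  map_mx f (mx2 a b c d) = mx2 (f a) (f b) (f c) (f d).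
Proof. by rewrite [LHS]mx2_eta !mxE. Qed.

Lemma invmx_mx2 (F : fieldType) (a b c d : F) : a * d - b * c != 0 ->
  invmx (mx2 a b c d) = (a * d - b * c)^-1 *: mx2 d (- b) (- c) a.
Proof.
move=> D0; set B := RHS.
have AB : mx2 a b c d *m B = 1%:M.
  rewrite -scalemxAr mul_mx2 scale_mx2 scalar_mx2.
  by congr mx2; field.
by rewrite -[LHS]mulmx1 -AB mulKmx // unitmxE det_mx2 unitfE.
Qed.

(** * Matrices with equal diagonal entries and equal off-diagonal entries *)

Section SymmetricMatrix2.
Variable F : fieldType.
Implicit Types p q z : F.

(** Transposing the adjugate pairs each entry with its own cofactor; opposite corners then yield the
    same product. *)
Lemma combined_mx2 (A : 'M[F]_2) (D := A 0 0 * A 1 1 - A 0 1 * A 1 0) : D != 0 ->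
  combined_mx A = mx2 (A 0 0 * A 1 1 / D) (- (A 0 1 * A 1 0) / D)
                      (- (A 0 1 * A 1 0) / D) (A 0 0 * A 1 1 / D).
Proof.
move=> D0; rewrite /combined_mx {2}(mx2_eta A) invmx_mx2 // scale_mx2 tr_mx2.
by rewrite [LHS]mx2_eta !mxE /= -/D; congr mx2; field.
Qed.

(** The eigenspace is a kernel, nonzero exactly when a determinant vanishes; here that determinant
    is a difference of two squares. *)
Lemma eigenvalue_mx2 p q z :
  eigenvalue (mx2 p q q p) z = (z == p + q) || (z == p - q).
Proof.
rewrite /eigenvalue /eigenspace kermx_eq0 row_free_unit unitmxE unitfE negbK.
rewrite scalar_mx2 sub_mx2 det_mx2.
rewrite (_ : _ - _ = (z - (p + q)) * (z - (p - q))); last by ring.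
by rewrite mulf_eq0 !subr_eq0.
Qed.

(** Partial fractions of the adjugate over the determinant: [z - p] and [q] are the half sum and the
    half difference of the factors [z - (p - q)] and [z - (p + q)]. With [q = 0] the two poles
    coincide and the formula still applies. *)
Lemma resolvent_mx2 p q z : (2 : F) != 0 -> z != p + q -> z != p - q ->
  let s := (z - (p + q))^-1 / 2 in let t := (z - (p - q))^-1 / 2 in
  invmx (z%:M - mx2 p q q p) = mx2 (s + t) (s - t) (s - t) (s + t).
Proof.
rewrite -!(subr_eq0 z) => two0 z1 z2 s t.
have E : (z - p) * (z - p) - (0 - q) * (0 - q) = (z - (p + q)) * (z - (p - q)) by ring.
rewrite scalar_mx2 sub_mx2 invmx_mx2 ?E ?mulf_neq0 // scale_mx2.
by congr mx2; rewrite /s /t; field; rewrite z1 z2 two0.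
Qed.

Lemma charpoly_mx2 p q : charpoly (mx2 p q q p) = ('X - (p + q)%:P) * ('X - (p - q)%:P).
Proof.
rewrite /charpoly map_mx2 scalar_mx2 sub_mx2 det_mx2 !rmorphD rmorphN /=; ring.
Qed.

Lemma eigenvector_mx2 p q (u v : F) (e : F) : e *: col2 u v = mx2 p q q p *m col2 u v ->
  u != 0 -> eigenvector (mx2 p q q p) (col2 u v).
Proof.
move=> E u0; split; last by exists e.
by apply: contraNneq u0 => /colP/(_ 0); rewrite !mxE /= => ->.
Qed.

Lemma basis_col2 : (2 : F) != 0 ->
  basis_of fullv [:: col2 1 1 : 'cV[F]_2; col2 1 (-1)].
Proof.
(* The list has as many vectors as the dimension, so it only has to span. *)
move=> two0; rewrite basisEdim dimvf /dim /= andbT.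
apply/subvP => v _; rewrite span_cons span_seq1.
have -> : v = ((v 0 0 + v 1 0) / 2) *: col2 1 1 + ((v 0 0 - v 1 0) / 2) *: col2 1 (-1).
  apply/colP => i; rewrite !mxE; case: i => [[|[|//]] hi] /=.
    by rewrite (_ : Ordinal hi = 0); [field|apply/val_inj].
  by rewrite (_ : Ordinal hi = 1); [field|apply/val_inj].
by rewrite memv_add // memvZ // memv_line.
Qed.

End SymmetricMatrix2.

(** Both roots lie in [K], so adjoining them gives nothing new: [L] is the base field, which every
    automorphism in the group fixes pointwise. *)
Lemma trivial_Gal_split (K : fieldType) (L : splittingFieldType K) (a b : K) :
  splittingFieldFor 1%VS (map_poly (in_alg L) (('X - a%:P) * ('X - b%:P))) {:L} ->
  'Gal({:L} / 1%VS)%g = 1%g.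
Proof.
case=> rs; rewrite rmorphM /= !map_polyXsubC => pE defL.
(* The list [rs] is known only through a product associated to the polynomial; comparing roots shows
   that each member is the image of [a] or [b]. *)
have rs1 : {subset rs <= 1%AS}.
  move=> x; rewrite -root_prod_XsubC -(eqp_root pE) rootM !root_XsubC.
  by case/orP => /eqP ->; rewrite rpredZ // mem1v.
have L1 : ({:L} <= 1)%VS by rewrite -defL; apply/Fadjoin_seqP.
apply/trivgP/fintype.subsetP => x Gx; rewrite inE; apply/gal_eqP => y _.
rewrite gal_id (fixed_gal _ Gx) ?subvf //.
by move/subvP: L1; apply; rewrite memvf.
Qed.

(** Turns the limit into a threshold [N], which may depend on [z]; over [R[i]] the inequality
    [0 < e] makes [e] real. *)
Lemma analytic_atP (C : numFieldType) (f : C -> C) (c : C) : analytic_at f c ->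
  exists (a : nat -> C) (e : C), 0 < e /\ forall z, `|z - c| < e ->
    forall eps, 0 < eps -> exists N, forall n, (N <= n)%N ->
      `|f z - \sum_(k < n) a k * (z - c) ^+ k| <= eps.
Proof.
case=> a /nbhs_normP[e /= e0 He]; exists a, e; split => // z ze eps eps0.
have /cvgrPdist_le /(_ _ eps0)[N _ HN] : series (fun k => a k * (z - c) ^+ k) @ \oo --> f z.
  by apply: He => /=; rewrite distrC.
by exists N => n Nn; have := HN n Nn; rewrite /series /= big_mkord.
Qed.

(** * Mean values over circles in [R[i]], towards Cauchy's formula *)

Section CauchyFormula.
Variable R : realType.
Local Notation C := R[i].
Local Notation normc := Normc.normc.
Local Notation Re := (@complex.Re R).
Local Notation Im := (@complex.Im R).
Implicit Types (F G : R -> C) (g h : C -> C) (c u v : C) (r e : R).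

Lemma ReD (x y : C) : Re (x + y) = Re x + Re y. Proof. by case: x; case: y. Qed.
Lemma ImD (x y : C) : Im (x + y) = Im x + Im y. Proof. by case: x; case: y. Qed.
Lemma ReM (x y : C) : Re (x * y) = Re x * Re y - Im x * Im y.
Proof. by case: x; case: y. Qed.
Lemma ImM (x y : C) : Im (x * y) = Re x * Im y + Im x * Re y.
Proof. by case: x; case: y. Qed.

Lemma normcD (x y : C) : normc (x + y) <= normc x + normc y.
Proof. exact: le_normcD. Qed.

Lemma normcN (x : C) : normc (- x) = normc x.
Proof. exact: complex.normcN. Qed.

Lemma normcBC (x y : C) : normc (x - y) = normc (y - x).
Proof. by rewrite -normcN opprB. Qed.

Lemma normc_ge0 (x : C) : 0 <= normc x.
Proof. by case: x => a b; exact: sqrtr_ge0. Qed.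

Lemma normc_gt0 (x : C) : (0 < normc x) = (x != 0).
Proof.
rewrite lt_neqAle normc_ge0 andbT eq_sym; congr (~~ _); apply/eqP/eqP => [|->].
  exact: Normc.eq0_normc.
exact: Normc.normc0.
Qed.

Lemma normcX (x : C) n : normc (x ^+ n) = normc x ^+ n.
Proof.
elim: n => [|n IH]; first by rewrite !expr0 Normc.normc1.
by rewrite !exprS Normc.normcM IH.
Qed.

Lemma normc_real r : normc r%:C%C = `|r|.
Proof. by rewrite /= expr0n addr0 sqrtr_sqr. Qed.

Lemma Re_normc (x : C) : `|Re x| <= normc x.
Proof. by case: x => a b /=; rewrite -sqrtr_sqr ler_wsqrtr // lerDl sqr_ge0. Qed.

Lemma Im_normc (x : C) : `|Im x| <= normc x.
Proof. by case: x => a b /=; rewrite -sqrtr_sqr ler_wsqrtr // lerDr sqr_ge0. Qed.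

Lemma normc_le (x : C) : normc x <= `|Re x| + `|Im x|.
Proof.
rewrite {1}(complexE x); apply: le_trans (normcD _ _) _.
by rewrite Normc.normcM !normc_real /= !(expr0n, expr1n) add0r sqrtr1 mul1r.
Qed.

Lemma normc_sum n (a : nat -> C) :
  normc (\sum_(k < n) a k) <= \sum_(k < n) normc (a k).
Proof.
elim: n => [|n IH]; first by rewrite !big_ord0 Normc.normc0.
by rewrite !big_ord_recr /=; apply: le_trans (normcD _ _) _; rewrite lerD2r.
Qed.

(** Convergence at one point at distance [s] from [c], with [r < s < rho], bounds the terms of the
    series there. This makes the tails on the smaller circle geometric, uniformly in [z], and a
    truncation of the series serves as [p]. *)
Lemma analytic_at_unif (f : C -> C) c : analytic_at f c ->
  exists2 rho : R, 0 < rho & forall r, 0 < r -> r < rho ->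
    forall e, 0 < e -> exists2 p : {poly C}, p.[0] = f c &
      forall z, normc (z - c) = r -> normc (f z - p.[z - c]) <= e.
Proof.
move=> /analytic_atP[a [[rho i0] []]].
rewrite ltcE /= => /andP[/eqP -> {i0} rho0] H; exists rho => // r r0 rrho e e0.
have {}H z : normc (z - c) < rho -> forall eps : R, 0 < eps -> exists N, forall n,
    (N <= n)%N -> normc (f z - \sum_(k < n) a k * (z - c) ^+ k) <= eps.
  move=> zrho eps eps0; have [||N HN] := H z _ eps%:C%C.
  - by rewrite /Num.norm /= ltcR.
  - by rewrite ltcR.
  by exists N => n /HN; rewrite /Num.norm /= lecR.
(* At [z = c] every nonempty partial sum equals [a 0], so the limit there is [a 0]; [N.+1] avoids
   the empty sum. *)
have fc : a 0%N = f c.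
  apply/eqP/negPn/negP; rewrite eq_sym -subr_eq0 -normc_gt0 => d0.
  have [|N HN] := H c _ (normc (f c - a 0%N) / 2) (divr_gt0 d0 (ltr0Sn _ _)).
    by rewrite subrr Normc.normc0.
  have := HN N.+1 (leqnSn _); rewrite big_ord_recl subrr expr0 mulr1.
  rewrite big1 ?addr0 => [|i _]; last by rewrite exprS mul0r mulr0.
  lra.
pose s := (r + rho) / 2.
have s0 : 0 < s by rewrite /s; lra.
have srho : s < rho by rewrite /s; lra.
have rs : r < s by rewrite /s; lra.
(* Beyond the threshold [N] at [c + s], successive partial sums are both within 1 of the value of
   [f], so each later term is at most 2; the first [N] terms are bounded by their sum. *)
have [B HB] : exists B, forall k, normc (a k) * s ^+ k <= B.
  have [|N HN] := H (c + s%:C%C) _ 1 ltr01.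
    by rewrite addrAC subrr add0r normc_real gtr0_norm.
  rewrite addrAC subrr add0r in HN.
  pose b k := normc (a k) * s ^+ k.
  exists (\sum_(k < N) b k + 2) => k; rewrite -/(b k).
  have b0 j : 0 <= b j by rewrite mulr_ge0 ?normc_ge0 // exprn_ge0 // ltW.
  have [kN|Nk] := ltnP k N.
    rewrite (bigD1 (Ordinal kN)) //= -addrA lerDl addr_ge0 ?sumr_ge0 //.
  have h1 := HN k Nk; have h2 := HN k.+1 (leqW Nk).
  have -> : b k = normc (a k * s%:C%C ^+ k).
    by rewrite Normc.normcM normcX normc_real (gtr0_norm s0).
  have -> : a k * s%:C%C ^+ k = (f (c + s%:C%C) - \sum_(k < k) a k * s%:C%C ^+ k)
     - (f (c + s%:C%C) - \sum_(k < k.+1) a k * s%:C%C ^+ k).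
    by rewrite big_ord_recr /=; ring.
  apply: le_trans (normcD _ _) _; rewrite normcN.
  have : 0 <= \sum_(k < N) b k by apply: sumr_ge0.
  lra.
pose q := r / s.
have q0 : 0 < q by rewrite divr_gt0.
have q1 : q < 1 by rewrite ltr_pdivrMr // mul1r.
have B0 : 0 <= B by apply: le_trans (HB 0%N); rewrite mulr_ge0 ?normc_ge0.
have tail z n m : normc (z - c) = r ->
    normc (\sum_(k < n + m) a k * (z - c) ^+ k - \sum_(k < n) a k * (z - c) ^+ k)
      <= B * q ^+ n / (1 - q).
  move=> zr; rewrite big_split_ord /= addrAC subrr add0r.
  apply: le_trans (normc_sum _ (fun k => a (n + k)%N * (z - c) ^+ (n + k))) _.
  apply: (@le_trans _ _ (\sum_(k < m) B * q ^+ n * q ^+ k)).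
    apply: ler_sum => k _; rewrite Normc.normcM normcX zr.
    have -> : r = q * s by rewrite /q mulfVK // gt_eqF.
    rewrite exprMn -mulrA -exprD mulrCA mulrC ler_wpM2r //.
    by rewrite exprn_ge0 // ltW.
  rewrite -mulr_sumr ler_wpM2l ?mulr_ge0 ?exprn_ge0 ?(ltW q0) //.
  have q1' : 0 < 1 - q by rewrite subr_gt0.
  rewrite -[_^-1]mul1r ler_pdivlMr // mulrC -opprB mulNr -subrX1 opprB.
  by rewrite lerBlDr lerDl exprn_ge0 // ltW.
have [n Hn] : exists n, B * q ^+ n.+1 / (1 - q) <= e / 2.
  have : (fun n => B / (1 - q) * q ^+ n) @ \oo --> B / (1 - q) * 0.
    by apply: cvgMr; apply: cvg_expr; rewrite ger0_norm // ltW.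
  rewrite mulr0 => /cvgrPdist_le /(_ (e / 2)) [|N _ HN]; first by lra.
  exists N; have := HN N.+1 (leqnSn _); rewrite sub0r normrN => h.
  by rewrite mulrAC; apply: le_trans (ler_norm _) h.
exists (\sum_(k < n.+1) a k *: 'X^k).
  rewrite horner_sum big_ord_recl hornerZ hornerXn expr0 mulr1 big1 ?addr0 // => i _.
  by rewrite hornerZ hornerXn exprS mul0r mulr0.
move=> z zr; rewrite horner_sum.
under eq_bigr do rewrite hornerZ hornerXn.
have [|N HN] := H z _ (e / 2) (divr_gt0 e0 (ltr0Sn _ _)); first by rewrite zr.
(* The threshold [N] depends on [z] but [n] does not; the longer sum of [n.+1 + N] terms links [f z]
   to the fixed truncation. *)
have h1 := HN (n.+1 + N)%N (leq_addl _ _).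
have h2 := tail z n.+1 N zr.
rewrite -(subrK (\sum_(k < n.+1 + N) a k * (z - c) ^+ k) (f z)) -addrA.
apply: le_trans (normcD _ _) _; lra.
Qed.

(* Agreeing up to any [e] on the circle [|z - c| = r] with a polynomial in [z - c]
   whose constant term is [v]; the mean value over the circle is then [v]. *)
Definition poly_approx c r g v := forall e, 0 < e ->
  exists2 p : {poly C}, p.[0] = v &
    forall z, normc (z - c) = r -> normc (g z - p.[z - c]) <= e.

Lemma poly_approx_horner c r (p : {poly C}) :
  poly_approx c r (fun z => p.[z - c]) p.[0].
Proof.
by move=> e e0; exists p => // z _; rewrite subrr Normc.normc0 ltW.
Qed.

(** Controls one factor of a product while the other is being approximated. *)
Lemma normc_horner_bounded (p : {poly C}) r :
  exists2 B : R, 0 <= B & forall w : C, normc w = r -> normc p.[w] <= B.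
Proof.
elim/poly_ind: p => [|p a [B B0 HB]].
  by exists 0 => // w _; rewrite horner0 Normc.normc0.
exists (B * `|r| + normc a) => [|w wr].
  by rewrite addr_ge0 ?mulr_ge0 ?normc_ge0.
rewrite hornerMXaddC; apply: le_trans (normcD _ _) _; rewrite lerD2r Normc.normcM wr.
by rewrite ler_pM ?normc_ge0 ?HB // -wr ?normc_ge0 ?ler_norm.
Qed.

Lemma poly_approxM c r g h u v : poly_approx c r g u -> poly_approx c r h v ->
  poly_approx c r (fun z => g z * h z) (u * v).
Proof.
(* An approximation of [g] within 1 serves only to bound [g]. Then [q] is chosen against that bound,
   and [p] last, against the bound of [q]. *)
move=> gu hv e e0; have [p1 _ Hp1] := gu 1 ltr01.
have [B B0 HB] := normc_horner_bounded p1 r.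
have gB z : normc (z - c) = r -> normc (g z) <= B + 1.
  move=> zr; rewrite -(subrK p1.[z - c] (g z)) addrC.
  by apply: le_trans (normcD _ _) _; rewrite lerD ?HB ?Hp1.
have [|q qv Hq] := hv (e / 2 / (B + 1)); first by rewrite !divr_gt0 //; lra.
have [B' B'0 HB'] := normc_horner_bounded q r.
have [|p pu Hp] := gu (e / 2 / (B' + 1)); first by rewrite !divr_gt0 //; lra.
exists (p * q) => [|z zr]; first by rewrite hornerM pu qv.
have -> : g z * h z - (p * q).[z - c] =
    g z * (h z - q.[z - c]) + (g z - p.[z - c]) * q.[z - c].
  by rewrite hornerM; ring.
apply: le_trans (normcD _ _) _; rewrite !Normc.normcM.
have -> : e = (B + 1) * (e / 2 / (B + 1)) + (e / 2 / (B' + 1)) * (B' + 1).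
  by field; rewrite !gt_eqF ?ltr_wpDl.
apply: lerD; apply: ler_pM; rewrite ?normc_ge0 ?gB ?Hq ?Hp //.
by apply: le_trans (HB' _ zr) _; rewrite lerDl.
Qed.

(** The pole [d] lies outside the circle, so on it [(z - c) / b] has constant modulus [q < 1], and
    [B] bounds the modulus of [(z - d)^-1]. *)
Lemma poly_approx_inv c r d : 0 < r -> r < normc (c - d) ->
  poly_approx c r (fun z => (z - d)^-1) (c - d)^-1.
Proof.
move=> r0; set b := c - d => rb e e0.
have b0 : 0 < normc b by lra.
pose q := r / normc b.
have q0 : 0 < q by rewrite divr_gt0.
have q1 : q < 1 by rewrite ltr_pdivrMr // mul1r.
pose B := (normc b - r)^-1.
have B0 : 0 < B by rewrite invr_gt0 subr_gt0.
have [n Hn] : exists n, q ^+ n.+1 * B <= e.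
  have : (fun n => B * q ^+ n) @ \oo --> B * 0.
    by apply: cvgMr; apply: cvg_expr; rewrite ger0_norm // ltW.
  rewrite mulr0 => /cvgrPdist_le /(_ e e0) [N _ HN].
  exists N; have := HN N.+1 (leqnSn _); rewrite sub0r normrN => h.
  by rewrite mulrC; apply: le_trans (ler_norm _) h.
(* iterate 1/(w + b) = 1/b - (w/b) (1/(w + b)), where w = z - c *)
suff [p p0 Hp] : exists2 p : {poly C}, p.[0] = b^-1 & forall z, normc (z - c) = r ->
    normc ((z - d)^-1 - p.[z - c]) <= q ^+ n.+1 * B.
  by exists p => // z zr; apply: le_trans Hn; exact: Hp.
have step z x : normc (z - c) = r ->
    normc ((z - d)^-1 - (b^-1 - (z - c) / b * x)) = q * normc ((z - d)^-1 - x).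
  move=> zr.
  have zd0 : z - d != 0.
    apply: contraTneq rb => /subr0_eq zd; rewrite /b -zd normcBC zr; lra.
  have bn0 : b != 0 by rewrite -normc_gt0.
  have -> : (z - d)^-1 - (b^-1 - (z - c) / b * x) = - ((z - c) / b * ((z - d)^-1 - x)).
    have -> : z - c = (z - d) - b by rewrite /b; ring.
    by field; rewrite bn0 zd0.
  by rewrite normcN 2!Normc.normcM Normc.normcV zr.
elim: n {Hn} => [|n [p p0 Hp]].
  exists (b^-1)%:P => [|z zr]; rewrite hornerC //.
  (* Taking [x = 0] in the iteration gives the approximant [b^-1]; what remains is that [z - d] has
     modulus at least [normc b - r]. *)
  have := step z 0 zr; rewrite mulr0 !subr0 => ->; rewrite expr1 ler_pM2l //.
  have h : normc b <= normc (z - d) + r.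
    rewrite -zr (normcBC z c); apply: le_trans (normcD _ _).
    by rewrite (_ : z - d + (c - z) = b) // /b; ring.
  rewrite Normc.normcV lef_pV2 ?posrE; lra.
exists ((b^-1)%:P - (b^-1 *: 'X) * p) => [|z zr].
  by rewrite hornerD hornerN hornerM hornerZ hornerX hornerC mulr0 mul0r subr0.
rewrite hornerD hornerN hornerM hornerZ hornerX hornerC (mulrC b^-1) step //.
by rewrite exprS -mulrA ler_pM2l // Hp.
Qed.

(** * Continuous functions and their integrals over [[0, 2 * pi]] *)

Lemma continuous_approx (F : R -> R) :
  (forall e, 0 < e -> exists2 G : R -> R, continuous G & forall t, `|F t - G t| <= e) ->
  continuous F.
Proof.
move=> H x; apply/cvgrPdist_le => e e0.
have e3 : 0 < e / 3 by rewrite divr_gt0.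
have [G cG HG] := H _ e3.
have /cvgrPdist_le /(_ _ e3) := cG x.
apply: filterS => t Gt; have h1 := HG x; have h2 := HG t; rewrite distrC in h2.
rewrite (_ : F x - F t = (F x - G x) + (G x - G t) + (G t - F t)); last by ring.
apply: le_trans (ler_normD _ _) _.
have := ler_normD (F x - G x) (G x - G t); lra.
Qed.

Lemma integrable02pi (F : R -> R) : continuous F ->
  lebesgue_measure.-integrable `[0, 2 * pi]%classic (EFin \o F).
Proof.
move=> cF; apply: continuous_compact_integrable; first exact: segment_compact.
exact: continuous_subspaceT.
Qed.

Lemma norm_integral02pi (F : R -> R) e : continuous F -> (forall t, `|F t| <= e) ->
  `|\int[lebesgue_measure]_(t in `[0, 2 * pi]) F t| <= e * (2 * pi).
Proof.
move=> cF He.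
have pi2 : 0 < 2 * pi :> R by rewrite mulr_gt0 ?pi_gt0.
apply: le_trans (le_normr_Rintegral _ _) _ => //; first exact: integrable02pi.
have -> : e * (2 * pi) = \int[lebesgue_measure]_(t in `[0, 2 * pi]) e.
  by rewrite Rintegral_cst //= lebesgue_measure_itv /= lte_fin pi2 /= subr0.
apply: le_Rintegral => //; apply: integrable02pi => // x; last exact: cvg_cst.
by apply: cvg_norm; exact: cF.
Qed.

Definition complex_continuous F := continuous (Re \o F) /\ continuous (Im \o F).

(** Shaped so that unfolding [circle_integral] gives an instance of it. *)
Definition integral02pi F : C :=
  ((\int[lebesgue_measure]_(t in `[0, 2 * pi]) Re (F t)) +i*
   (\int[lebesgue_measure]_(t in `[0, 2 * pi]) Im (F t)))%C.

Lemma complex_continuous_cst u : complex_continuous (fun=> u).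
Proof. by split=> x; exact: cvg_cst. Qed.

Lemma complex_continuousD F G : complex_continuous F -> complex_continuous G ->
  complex_continuous (fun t => F t + G t).
Proof.
move=> [F1 F2] [G1 G2]; split.
  rewrite [X in continuous X](_ : _ = (Re \o F) \+ (Re \o G)); last first.
    by apply/funext => t /=; rewrite ReD.
  by move=> t; apply: cvgD; [exact: F1|exact: G1].
rewrite [X in continuous X](_ : _ = (Im \o F) \+ (Im \o G)); last first.
  by apply/funext => t /=; rewrite ImD.
by move=> t; apply: cvgD; [exact: F2|exact: G2].
Qed.

Lemma complex_continuousM F G : complex_continuous F -> complex_continuous G ->
  complex_continuous (fun t => F t * G t).
Proof.
move=> [F1 F2] [G1 G2]; split.
  rewrite [X in continuous X](_ : _ =
    fun t => (Re \o F) t * (Re \o G) t - (Im \o F) t * (Im \o G) t); last first.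
    by apply/funext => t /=; rewrite ReM.
  by move=> t; apply: cvgB; apply: cvgM; [exact: F1|exact: G1|exact: F2|exact: G2].
rewrite [X in continuous X](_ : _ =
  fun t => (Re \o F) t * (Im \o G) t + (Im \o F) t * (Re \o G) t); last first.
  by apply/funext => t /=; rewrite ImM.
by move=> t; apply: cvgD; apply: cvgM; [exact: F1|exact: G2|exact: F2|exact: G1].
Qed.

(** Uniform limits of continuous functions are continuous; this supplies the continuity of functions
    known on the circle only through polynomial approximation. *)
Lemma complex_continuous_approx F :
  (forall e, 0 < e -> exists2 G, complex_continuous G & forall t, normc (F t - G t) <= e) ->
  complex_continuous F.
Proof.
move=> H; split; apply: continuous_approx => e /H[G [G1 G2] HG].
  exists (Re \o G) => // t /=; have := Re_normc (F t - G t).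
  by rewrite ReD; case: (G t) (HG t) => /= x y h /le_trans; apply.
exists (Im \o G) => // t /=; have := Im_normc (F t - G t).
by rewrite ImD; case: (G t) (HG t) => /= x y h /le_trans; apply.
Qed.

Lemma integral02piD F G : complex_continuous F -> complex_continuous G ->
  integral02pi (fun t => F t + G t) = integral02pi F + integral02pi G.
Proof.
move=> [F1 F2] [G1 G2]; rewrite /integral02pi.
under eq_Rintegral do rewrite ReD.
under [in X in (_ +i* X)%C]eq_Rintegral do rewrite ImD.
by rewrite !RintegralD //; exact: integrable02pi.
Qed.

Lemma integral02piZ u F : complex_continuous F ->
  integral02pi (fun t => u * F t) = u * integral02pi F.
Proof.
move=> [F1 F2]; case: u => a b; rewrite /integral02pi.
under eq_Rintegral do rewrite ReM /=.
under [in X in (_ +i* X)%C]eq_Rintegral do rewrite ImM /=.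
have sc x (H : R -> R) : continuous H -> continuous (fun t => x * H t).
  by move=> cH t; apply: cvgM; [exact: cvg_cst|exact: cH].
rewrite RintegralB ?RintegralD //; try by apply: integrable02pi; apply: sc.
by rewrite !RintegralZl //; exact: integrable02pi.
Qed.

(** Each component contributes [e * (2 * pi)]; the factor 2 lost against the sharp bound is
    harmless, since [e] can be chosen freely. *)
Lemma normc_integral02pi F e : complex_continuous F -> (forall t, normc (F t) <= e) ->
  normc (integral02pi F) <= e * (4 * pi).
Proof.
move=> [F1 F2] He; apply: le_trans (normc_le _) _.
rewrite (_ : e * (4 * pi) = e * (2 * pi) + e * (2 * pi)); last by ring.
apply: lerD; apply: norm_integral02pi => // t.
  exact: le_trans (Re_normc _) (He t).
exact: le_trans (Im_normc _) (He t).
Qed.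

Lemma integral02pi_cst u : integral02pi (fun=> u) = (2 * pi)%:C%C * u.
Proof.
have pi2 : 0 < 2 * pi :> R by rewrite mulr_gt0 ?pi_gt0.
rewrite /integral02pi !Rintegral_cst //= lebesgue_measure_itv /= lte_fin pi2 /= subr0.
by case: u => a b /=; simpc; rewrite ![_ * (2 * pi)]mulrC.
Qed.

Lemma integral02pi_derive (F f : R -> R) : (forall t : R, is_derive t 1 F (f t)) ->
  continuous f -> \int[lebesgue_measure]_(t in `[0, 2 * pi]) f t = F (2 * pi) - F 0.
Proof.
move=> Ff cf.
have pi2 : 0 < 2 * pi :> R by rewrite mulr_gt0 ?pi_gt0.
have cF : continuous F.
  by move=> t; apply: differentiable_continuous; apply/derivable1_diffP; case: (Ff t).
rewrite /Rintegral (@continuous_FTC2 _ _ F) //.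
- exact: continuous_subspaceT.
- split => [t _||]; first by case: (Ff t).
    by apply: cvg_at_right_filter; exact: cF.
  by apply: cvg_at_left_filter; exact: cF.
- by move=> t _; rewrite derive1E; apply: derive_val.
Qed.

(** * Powers and polynomials on a circle, and Cauchy's formula *)

Lemma circle_ptB c r (t : R) : circle_pt c r t - c = (r * cos t +i* (r * sin t))%C.
Proof. by rewrite /circle_pt addrAC subrr add0r. Qed.

Lemma normc_circle_pt c r (t : R) : 0 < r -> normc (circle_pt c r t - c) = r.
Proof.
move=> r0; rewrite circle_ptB /= !exprMn -mulrDr cos2Dsin2 mulr1 sqrtr_sqr.
by rewrite gtr0_norm.
Qed.

Lemma complex_continuous_circle c r : complex_continuous (fun t => circle_pt c r t - c).
Proof.
rewrite (_ : (fun _ => _) = fun t => (r * cos t +i* (r * sin t))%C); last first.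
  by apply/funext => t; rewrite circle_ptB.
split=> t /=; apply: cvgM; try exact: cvg_cst.
  exact: continuous_cos.
exact: continuous_sin.
Qed.

Lemma complex_continuous_horner c r (p : {poly C}) :
  complex_continuous (fun t => p.[circle_pt c r t - c]).
Proof.
elim/poly_ind: p => [|p a IH].
  by under eq_fun do rewrite horner0; exact: complex_continuous_cst.
under eq_fun do rewrite hornerMXaddC.
apply: complex_continuousD; last exact: complex_continuous_cst.
by apply: complex_continuousM => //; exact: complex_continuous_circle.
Qed.

(** De Moivre's formula. *)
Lemma circle_ptX c r (t : R) n : (circle_pt c r t - c) ^+ n =
  (r ^+ n)%:C%C * (cos (n%:R * t) +i* sin (n%:R * t))%C.
Proof.
rewrite circle_ptB; elim: n => [|n IH]; first by rewrite !expr0 mul0r cos0 sin0 mulr1.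
rewrite exprSr IH -natr1 mulrDl mul1r cosD sinD exprSr.
by apply/eqP; rewrite eq_complex /=; apply/andP; split; apply/eqP; ring.
Qed.

(** The primitives of the cosine and sine of [n.+1%:R * t] take equal values at 0 and [2 * pi]. The
    exponent 0 is excluded, as its mean value is 1. *)
Lemma integral02pi_circle_ptX c r n :
  integral02pi (fun t => (circle_pt c r t - c) ^+ n.+1) = 0.
Proof.
have n0 : n.+1%:R != 0 :> R by rewrite pnatr_eq0.
have D (x : R) : is_derive x 1 (fun t : R => n.+1%:R * t : R) (n.+1%:R : R).
  by apply: is_derive_eq; rewrite /GRing.scale /= mulr1.
have Ds (x : R) : is_derive x 1 (fun t : R => sin (n.+1%:R * t)) (cos (n.+1%:R * x) * n.+1%:R).
  exact: (@is_derive1_comp _ sin (fun t => n.+1%:R * t)).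
have Dc (x : R) : is_derive x 1 (fun t : R => cos (n.+1%:R * t)) (- sin (n.+1%:R * x) * n.+1%:R).
  exact: (@is_derive1_comp _ cos (fun t => n.+1%:R * t)).
have cM : continuous (fun t : R => n.+1%:R * t).
  by move=> t; apply: cvgM; [exact: cvg_cst|exact: cvg_id].
have cs : continuous (fun t : R => sin (n.+1%:R * t)).
  by move=> t; apply: continuous_comp; [exact: cM|exact: continuous_sin].
have cc : continuous (fun t : R => cos (n.+1%:R * t)).
  by move=> t; apply: continuous_comp; [exact: cM|exact: continuous_cos].
(* Written as a shift of 0 by [n.+1] periods, the form in which periodicity applies. *)
have e : n.+1%:R * (2 * pi) = 0 + pi *+ 2 *+ n.+1 :> R.
  by rewrite add0r !mulr_natl.
rewrite (_ : (fun _ => _) = fun t => (r ^+ n.+1)%:C%C *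
    (cos (n.+1%:R * t) +i* sin (n.+1%:R * t))%C); last first.
  by apply/funext => t; rewrite circle_ptX.
rewrite integral02piZ; last by split.
rewrite [integral02pi _](_ : _ = 0) ?mulr0 //.
have Is (x : R) : is_derive x 1 (fun t : R => n.+1%:R^-1 * sin (n.+1%:R * t) : R)
    (cos (n.+1%:R * x)).
  by apply: is_derive_eq; rewrite /GRing.scale /= mulrCA mulVf // mulr1.
have Ic (x : R) : is_derive x 1 (fun t : R => - n.+1%:R^-1 * cos (n.+1%:R * t) : R)
    (sin (n.+1%:R * x)).
  apply: is_derive_eq.
  by rewrite /GRing.scale /= !mulNr mulrN opprK mulrCA mulVf // mulr1.
apply/eqP; rewrite eq_complex /integral02pi /=; apply/andP; split; apply/eqP.
  rewrite (integral02pi_derive Is cc).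
  by rewrite e (periodicn (@sinD2pi R)) mulr0 subrr.
rewrite (integral02pi_derive Ic cs).
by rewrite e (periodicn (@cosD2pi R)) mulr0 subrr.
Qed.

Lemma integral02pi_horner c r (p : {poly C}) :
  integral02pi (fun t => p.[circle_pt c r t - c]) = (2 * pi)%:C%C * p.[0].
Proof.
(* The extra power [k] makes the induction go through: in [p * 'X + a] the factor ['X] raises the
   exponent to [k.+1], where the integral vanishes, and [a] counts only when [k = 0]. *)
suff H k : integral02pi (fun t => p.[circle_pt c r t - c] * (circle_pt c r t - c) ^+ k) =
    if k == 0%N then (2 * pi)%:C%C * p.[0] else 0.
  by have := H 0%N; under eq_fun do rewrite expr0 mulr1.
have cX n : complex_continuous (fun t => (circle_pt c r t - c) ^+ n).
  have := complex_continuous_horner c r 'X^n.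
  by under eq_fun do rewrite hornerXn.
elim/poly_ind: p k => [|p a IH] k.
  under eq_fun do rewrite horner0 mul0r.
  by rewrite integral02pi_cst horner0 mulr0; case: ifP.
under eq_fun do rewrite hornerMXaddC mulrDl -mulrA -exprS.
rewrite integral02piD; first last.
- by apply: complex_continuousM => //; exact: complex_continuous_cst.
- by apply: complex_continuousM => //; exact: complex_continuous_horner.
rewrite IH add0r integral02piZ // hornerMXaddC mulr0 add0r.
case: k => [|k]; last by rewrite integral02pi_circle_ptX mulr0.
by under eq_fun do rewrite expr0; rewrite integral02pi_cst mulr1 mulrC.
Qed.

(** Since [dz = i (z - c) dt], the integrand becomes [i h]. The integral of [h] is arbitrarily close
    to that of a polynomial with constant term [v], which is [2 pi v]. *)
Lemma cauchy_formula c r g h v : 0 < r -> poly_approx c r h v ->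
  (forall z, normc (z - c) = r -> g z * (z - c) = h z) ->
  circle_integral g c r = 2 * 'i%C * pi%:C%C * v.
Proof.
move=> r0 hv gh.
have -> : circle_integral g c r = integral02pi (fun t => 'i%C * h (circle_pt c r t)).
  rewrite /circle_integral; congr integral02pi; apply/funext => t.
  by rewrite mulrCA gh // normc_circle_pt.
have ch : complex_continuous (fun t => h (circle_pt c r t)).
  apply: complex_continuous_approx => e /hv[p _ Hp].
  exists (fun t => p.[circle_pt c r t - c]); first exact: complex_continuous_horner.
  by move=> t; apply: Hp; exact: normc_circle_pt.
rewrite integral02piZ //.
suff -> : integral02pi (fun t => h (circle_pt c r t)) = (2 * pi)%:C%C * v.
  by rewrite rmorphM /= rmorph_nat; ring.
apply/eqP/negPn/negP; rewrite -subr_eq0 -normc_gt0 => d0.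
have pi0 := pi_gt0 R.
set x := normc _ in d0.
(* This tolerance times the constant [4 * pi] of the integral bound gives [x <= x / 2], against
   [0 < x]. *)
have e0 : 0 < x / (8 * pi) by rewrite divr_gt0 // mulr_gt0.
have [p pv Hp] := hv _ e0.
have cp := complex_continuous_horner c r p.
have cNp : complex_continuous (fun t => -1 * p.[circle_pt c r t - c]).
  by apply: complex_continuousM => //; exact: complex_continuous_cst.
have Hd t : normc (h (circle_pt c r t) + -1 * p.[circle_pt c r t - c]) <= x / (8 * pi).
  by rewrite mulN1r; apply: Hp; exact: normc_circle_pt.
have := normc_integral02pi (complex_continuousD ch cNp) Hd.
rewrite integral02piD // integral02piZ // integral02pi_horner pv mulN1r.
have E y : 0 < y -> x / (8 * y) * (4 * y) = x / 2.
  by move=> y0; field; rewrite gt_eqF.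
rewrite -/x E //; lra.
Qed.

(** Multiplying by [z - c] removes the pole at [c], and for [r] below the distance from [c] to [d]
    the other pole stays outside the circle. *)
Lemma circle_integral_residue (f g : C -> C) c d (e1 e2 : C) : analytic_at f c -> c != d ->
  (forall z, z != c -> z != d -> g z = e1 / (z - c) + e2 / (z - d)) ->
  \forall r \near 0^'+,
    circle_integral (fun z => f z * g z) c r = 2 * 'i%C * pi%:C%C * (e1 * f c).
Proof.
move=> /analytic_at_unif[rho rho0 fP] cd gE.
have b0 : 0 < normc (c - d) by rewrite normc_gt0 subr_eq0.
near=> r.
have r0 : 0 < r by near: r; exact: nbhs_right_gt.
have rb : r < normc (c - d) by near: r; exact: nbhs_right_lt.
have rrho : r < rho by near: r; exact: nbhs_right_lt.
(* The numerator of [(z - c) * g z] over [z - d], in the variable [w = z - c], for which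
   [z - d = w + (c - d)]; its value at 0 is [e1 * (c - d)]. *)
pose p : {poly C} := e1 *: ('X + (c - d)%:P) + e2 *: 'X.
have pE w : p.[w] = e1 * (w + (c - d)) + e2 * w.
  by rewrite hornerD !hornerZ hornerD hornerX hornerC.
have := poly_approxM (fP r r0 rrho)
  (poly_approxM (poly_approx_horner c r p) (poly_approx_inv r0 rb)).
rewrite pE mulr0 addr0 add0r mulfK ?subr_eq0 // (mulrC (f c)).
move=> /(cauchy_formula r0); apply=> z zr.
have zc : z - c != 0 by rewrite -normc_gt0 zr.
have zd : z - d != 0.
  by apply: contraTneq rb => /subr0_eq zd; rewrite -zd normcBC zr ltxx.
rewrite gE -1?subr_eq0 // pE; field; by rewrite zc zd.
Unshelve. all: by end_near. Qed.

End CauchyFormula.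

(** The partial fractions of the resolvent give one residue per eigenvalue, entry by entry. Equal
    eigenvalues form a separate case, as the spectrum is a set and counts them once. *)
Lemma matrix_function_mx2 (R : realType) (p q : R[i]) (f : R[i] -> R[i]) :
  analytic_at f (p + q) -> analytic_at f (p - q) ->
  is_matrix_function f (mx2 p q q p)
    (2^-1 *: (mx2 1 1 1 (-1) *m mx2 (f (p + q)) 0 0 (f (p - q)) *m mx2 1 1 1 (-1))).
Proof.
set a := p + q; set d := p - q; set M := mx2 p q q p => fa fd.
have two0 : (2 : R[i]) != 0 by rewrite pnatr_eq0.
(* Entries of the projection onto the line of [(1, -1)]; those of the projection onto the line of
   [(1, 1)] are all [2^-1]. *)
pose s (i j : 'I_2) : R[i] := if i == j then 2^-1 else - 2^-1.
have BE : 2^-1 *: (mx2 1 1 1 (-1) *m mx2 (f a) 0 0 (f d) *m mx2 1 1 1 (-1)) =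
    \matrix_(i, j) (2^-1 * f a + s i j * f d).
  by rewrite !mul_mx2 scale_mx2 [RHS]mx2_eta !mxE /s /=; congr mx2; ring.
have resE i j z : z != a -> z != d ->
    invmx (z%:M - M) i j = 2^-1 / (z - a) + s i j / (z - d).
  move=> za zd; rewrite resolvent_mx2 // mxE /s.
  by case: i j => [[|[|//]] hi] [[|[|//]] hj] /=; rewrite ?[2^-1 / _]mulrC //
     ?mulNr ?[2^-1 / _]mulrC.
have specE : spectrum M = [set a; d].
  apply/seteqP; split=> z; rewrite /spectrum /= eigenvalue_mx2.
    by case/orP => /eqP; [left|right].
  by case=> ->; rewrite eqxx ?orbT.
have i2pi0 : 2 * 'i%C * (pi : R)%:C%C != 0 :> R[i].
  rewrite !mulf_neq0 //; first by rewrite eq_complex /= oner_eq0 andbF.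
  by rewrite eq_complex /= negb_and gt_eqF ?pi_gt0.
rewrite /is_matrix_function BE.
have [ad|ad] := eqVneq a d.
  (* The two poles merge; [a + 1] is a dummy second pole with residue 0. *)
  have a1 : a != a + 1 by rewrite -subr_eq0 opprD addNKr oppr_eq0 oner_eq0.
  have H i j := @circle_integral_residue _ f (fun z => invmx (z%:M - M) i j) a (a + 1)
    (2^-1 + s i j) 0 fa a1.
  have {}H i j : \forall r \near 0^'+,
      circle_integral (fun z => f z * invmx (z%:M - M) i j) a r =
      2 * 'i%C * pi%:C%C * ((2^-1 + s i j) * f a).
    by apply: H => z za _; rewrite resE -?ad // mul0r addr0 -mulrDl.
  near=> r; apply/matrixP => i j; rewrite !mxE specE -ad setUid fsbig_set1.
  rewrite (_ : circle_integral _ _ _ = 2 * 'i%C * pi%:C%C * ((2^-1 + s i j) * f a)).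
    by rewrite mulKf // mulrDl.
  (* There are finitely many entries, so one range of small radii serves them all. *)
  by move: i j; near: r; apply: filter_forall => i; apply: filter_forall => j; exact: H.
have da : d != a by rewrite eq_sym.
have H1 i j : \forall r \near 0^'+,
    circle_integral (fun z => f z * invmx (z%:M - M) i j) a r =
    2 * 'i%C * pi%:C%C * (2^-1 * f a).
  by apply: (circle_integral_residue fa ad) => z; exact: resE.
have H2 i j : \forall r \near 0^'+,
    circle_integral (fun z => f z * invmx (z%:M - M) i j) d r =
    2 * 'i%C * pi%:C%C * (s i j * f d).
  by apply: (circle_integral_residue fd da) => z zd za; rewrite resE // addrC.
near=> r; apply/matrixP => i j; rewrite !mxE specE fsbigU0 //; last first.
  by move=> z /= [-> /eqP]; rewrite (negbTE ad).
rewrite !fsbig_set1.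
rewrite (_ : circle_integral _ a _ = 2 * 'i%C * pi%:C%C * (2^-1 * f a)).
  rewrite (_ : circle_integral _ d _ = 2 * 'i%C * pi%:C%C * (s i j * f d)).
    by rewrite /= -mulrDr mulKf.
  by move: i j; near: r; apply: filter_forall => i; apply: filter_forall => j; exact: H2.
by move: i j; near: r; apply: filter_forall => i; apply: filter_forall => j; exact: H1.
Unshelve. all: by end_near. Qed.

Theorem proposition1 (R : realType) (K : fieldExtType rat)
    (iota : {rmorphism K -> R[i]}) (A : 'M[K]_2) (hA : A \in unitmx) :
  let CA : 'M[K]_2 := combined_mx A in
  let M : 'M[R[i]]_2 := map_mx iota CA in
  let d : R[i] := iota (\det CA) in
  let P : 'M[R[i]]_2 := (sqrtC 2)^-1 *: mx2 1 1 1 (-1) in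
  let D : 'M[R[i]]_2 := mx2 1 0 0 d in
  [/\ \tr CA = 2 / \det A * (A 0 0 * A 1 1),
      \det CA = (\det A)^-1 * (A 0 0 * A 1 1 + A 0 1 * A 1 0),
      charpoly CA =
        'X^2
        - (2 * A 0 0 * A 1 1 / (A 0 0 * A 1 1 - A 0 1 * A 1 0))%:P * 'X
        + ((A 0 0 * A 1 1 + A 0 1 * A 1 0)
           / (A 0 0 * A 1 1 - A 0 1 * A 1 0))%:P
    & spectrum M = [set 1; d]] /\
  [/\ [/\ basis_of fullv [:: col2 1 1 : 'cV[R[i]]_2; col2 1 (-1)],
          eigenvector M (col2 1 1)
        & eigenvector M (col2 1 (-1))],
      forall L : splittingFieldType K,
        splittingFieldFor 1%VS (map_poly (in_alg L) (charpoly CA)) {:L} ->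
        'Gal({:L} / 1%VS)%g = 1%g,
      [/\ P = P^T, orthogonal_mx P & M = P *m D *m P^T]
    & forall f : R[i] -> R[i],
        analytic_at f 1 -> analytic_at f d ->
        is_matrix_function f M
          (2^-1 *: (mx2 1 1 1 (-1) *m mx2 (f 1) 0 0 (f d)
                    *m mx2 1 1 1 (-1)))].
Proof.
move=> CA M d P D.
pose det := A 0 0 * A 1 1 - A 0 1 * A 1 0.
have detE : \det A = det by rewrite {1}(mx2_eta A) det_mx2.
have det0 : det != 0 by rewrite -detE -unitfE -unitmxE.
pose p := A 0 0 * A 1 1 / det; pose q := - (A 0 1 * A 1 0) / det.
have CAE : CA = mx2 p q q p by rewrite /CA combined_mx2.
(* Each row of [CA] sums to 1, which makes 1 an eigenvalue with eigenvector [(1, 1)]. *)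
have pq : p + q = 1 by rewrite /p /q -mulrDl divff.
(* The determinant is [(p - q) * (p + q)], and the second factor is 1. *)
have detCA : \det CA = p - q.
  by rewrite CAE det_mx2 -[RHS]mulr1 -pq; ring.
have ME : M = mx2 (iota p) (iota q) (iota q) (iota p) by rewrite /M CAE map_mx2.
have pqi : iota p + iota q = 1 by rewrite -rmorphD pq rmorph1.
have dE : d = iota p - iota q by rewrite /d detCA rmorphB.
have two0 : (2 : R[i]) != 0 by rewrite pnatr_eq0.
(* Both roots lie in [K]; this splitting serves the expanded polynomial as well as the Galois
   group. *)
have charE : charpoly CA = ('X - 1%:P) * ('X - (\det CA)%:P).
  by rewrite {1}CAE charpoly_mx2 pq detCA.
split; split.
- by rewrite CAE trace_mx2 detE /p; field.
- by rewrite detCA detE /p /q; field.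
- rewrite charE.
  (* The trace [2 * p] is the sum of the roots [p + q] and [p - q]. *)
  have -> : 2 * A 0 0 * A 1 1 / det = 1 + \det CA.
    by rewrite -[X in _ = X + _]pq detCA /p; ring.
  have -> : (A 0 0 * A 1 1 + A 0 1 * A 1 0) / det = \det CA.
    by rewrite detCA /p /q; ring.
  by rewrite rmorphD /= polyC1; ring.
- apply/seteqP; split=> z; rewrite /spectrum /= ME eigenvalue_mx2 pqi -dE.
    by case/orP => /eqP; [left|right].
  by case=> ->; rewrite eqxx ?orbT.
- split; first exact: basis_col2.
    rewrite ME; apply: (eigenvector_mx2 (e := 1)); last exact: oner_neq0.
    by rewrite mul_mx2_col scale_col2 !mulr1 (addrC (iota q)) pqi.
  rewrite ME; apply: (eigenvector_mx2 (e := d)); last exact: oner_neq0.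
  by rewrite mul_mx2_col scale_col2 dE; congr col2; ring.
- by move=> L; rewrite charE; exact: trivial_Gal_split.
- have PT : P^T = P by rewrite /P linearZ /= tr_mx2.
  (* [P] occurs twice in each product below, so only the square of [sqrtC 2] enters. *)
  have s2 : (sqrtC 2)^-1 * (sqrtC 2)^-1 = 2^-1 :> R[i].
    by rewrite -invfM -expr2 sqrtCK.
  split; rewrite ?PT // /orthogonal_mx ?PT.
    rewrite /P -scalemxAl -scalemxAr scalerA s2 mul_mx2 scale_mx2 scalar_mx2.
    by congr mx2; field.
  rewrite /P /D -!scalemxAl -scalemxAr scalerA s2 !mul_mx2 scale_mx2 ME.
  (* The entries are the half sum and the half difference of the eigenvalues 1 and [d]. *)
  have -> : iota p = (1 + d) / 2 by rewrite -[X in (X + _) / _]pqi dE; field.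
  have -> : iota q = (1 - d) / 2 by rewrite -[X in (X - _) / _]pqi dE; field.
  by congr mx2; field.
- move=> f; have := @matrix_function_mx2 R (iota p) (iota q) f.
  by rewrite pqi -dE ME.
Qed.
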